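(* Let $F\in\mathcal{H}^d$ with homogeneity matrix $A$. If there exists $\mathbf{b}\in\mathbb{R}^d_{++}$ such that $\sum_{i=1}^d b_i=1$ and $A^\top\mathbf{b}=\mathbf{b}$, then there exist $\mathbf{u}\in\mathbb{S}_+$ and $\boldsymbol{\lambda}\in\mathbb{R}^d_+$ such that $F(\mathbf{u})=\boldsymbol{\lambda}\otimes\mathbf{u}$ and $r_{\mathbf{b}}(F)=\prod_{i=1}^d\lambda_i^{b_i}$. Furthermore, $$r_{\mathbf{b}}(F)=\sup_{\mathbf{x}\in\mathcal{K}_{+,0}}\ \limsup_{m\to\infty}\ \prod_{i=1}^d\|F^m_i(\mathbf{x})\|_{\gamma_i}^{b_i/m}=\lim_{m\to\infty}\ \sup_{\mathbf{x}\in\mathbb{S}_+}\ \prod_{i=1}^d\|F^m_i(\mathbf{x})\|_{\gamma_i}^{b_i/m},$$ where $F^m=(F^m_1,\dots,F^m_d)$ is the $m$-fold composition of $F$ with itself.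
   Context: Fix positive integers $d,n_1,\dots,n_d$ and write $[n]=\{1,\dots,n\}$. Let $V=\mathbb{R}^{n_1}\times\cdots\times\mathbb{R}^{n_d}$, $\mathcal{K}_+=\mathbb{R}^{n_1}_+\times\cdots\times\mathbb{R}^{n_d}_+$ (vectors with nonnegative entries), and let $\mathcal{K}_{++}$ be its interior (all entries positive). Let $\mathcal{K}_{+,0}=\{\mathbf{x}\in\mathcal{K}_+:\mathbf{x}_i\neq0\ \forall i\in[d]\}$. Elements are written $\mathbf{x}=(\mathbf{x}_1,\dots,\mathbf{x}_d)$ with $\mathbf{x}_i\in\mathbb{R}^{n_i}$. Write $\mathbf{x}\le_{\mathcal{K}}\mathbf{y}$ if $\mathbf{y}-\mathbf{x}\in\mathcal{K}_+$. For $\boldsymbol{\alpha}\in\mathbb{R}^d$, $\mathbf{x}\in V$ set $\boldsymbol{\alpha}\otimes\mathbf{x}=(\alpha_1\mathbf{x}_1,\dots,\alpha_d\mathbf{x}_d)$. For $\boldsymbol{\alpha}\in\mathbb{R}^d_+$ and a nonnegative $d\times d$ matrix $A$ set $\boldsymbol{\alpha}^A=(\prod_k\alpha_k^{A_{1,k}},\dots,\prod_k\alpha_k^{A_{d,k}})$ (with $0^0=1$). $\mathcal{H}^d$ is the set of continuous maps $F=(F_1,\dots,F_d):\mathcal{K}_+\to\mathcal{K}_+$ such that: (i) there is a nonnegative $d\times d$ matrix $A$ (the homogeneity matrix of $F$) with $F(\boldsymbol{\alpha}\otimes\mathbf{x})=\boldsymbol{\alpha}^A\otimes F(\mathbf{x})$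 for all $\boldsymbol{\alpha}\in\mathbb{R}^d_+$, $\mathbf{x}\in\mathcal{K}_+$; (ii) $F$ is order-preserving: $\mathbf{x}\le_{\mathcal{K}}\mathbf{y}$ implies $F(\mathbf{x})\le_{\mathcal{K}}F(\mathbf{y})$; (iii) $F$ is nondegenerate: $F(\mathcal{K}_{++})\subset\mathcal{K}_{++}$ and $A\mathbb{R}^d_{++}\subset\mathbb{R}^d_{++}$. Each $\mathbb{R}^{n_i}$ carries a fixed norm $\|\cdot\|_{\gamma_i}$ that is monotonic: $\|\mathbf{x}_i\|_{\gamma_i}\le\|\mathbf{y}_i\|_{\gamma_i}$ whenever $|\mathbf{x}_i|\le|\mathbf{y}_i|$ entrywise. $\mathbb{S}_+=\{\mathbf{x}\in\mathcal{K}_+:\|\mathbf{x}_i\|_{\gamma_i}=1\ \forall i\in[d]\}$. The spectral radius is $$r_{\mathbf{b}}(F)=\sup\Big\{\prod_{i=1}^d\lambda_i^{b_i}\ :\ F(\mathbf{x})=\boldsymbol{\lambda}\otimes\mathbf{x}\text{ for some }\mathbf{x}\in\mathbb{S}_+,\ \boldsymbol{\lambda}\in\mathbb{R}^d_+\Big\}.$$ *)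

(* Defs.v *)
From mathcomp Require Import all_boot all_order all_algebra.
From mathcomp Require Import all_classical all_reals all_analysis.

Set Implicit Arguments.
Unset Strict Implicit.
Unset Printing Implicit Defensive.

Import Order.TTheory GRing.Theory Num.Theory.
Import numFieldNormedType.Exports.

Local Open Scope classical_set_scope.
Local Open Scope ring_scope.

Section MultiHomogeneous.
Context {R : realType} {d : nat}.

(* The space R^{n_1} x ... x R^{n_d}, with its product topology. *)
Definition pvec (n : 'I_d -> nat) : Type :=
  prod_topology (fun i : 'I_d => 'cV[R]_(n i)).

Context {n : 'I_d -> nat}.

Definition Kplus : set (pvec n) :=
  [set x | forall i, x i \is a mxOver Num.nneg].

Definition Kpos : set (pvec n) :=
  [set x | forall i, x i \is a mxOver Num.pos].

Definition Kplus0 : set (pvec n) :=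
  [set x | Kplus x /\ forall i, x i != 0].

Definition leK (x y : pvec n) : Prop := Kplus (fun i => y i - x i).

Definition scale (alpha : 'cV[R]_d) (x : pvec n) : pvec n :=
  fun i => alpha i 0 *: x i.

(* For nonnegative alpha and A; powR satisfies 0 `^ 0 = 1. *)
Definition mxpow (alpha : 'cV[R]_d) (A : 'M[R]_d) : 'cV[R]_d :=
  \col_i \prod_k (alpha k 0) `^ (A i k).

(* F belongs to H^d and A is its homogeneity matrix. A map K_+ -> K_+ is
   encoded as a total function, whose values outside K_+ are unconstrained. *)
Record in_Hd (F : pvec n -> pvec n) (A : 'M[R]_d) : Prop := InHd {
  Hd_maps : forall x, Kplus x -> Kplus (F x);
  Hd_continuous : {within Kplus, continuous F};
  Hd_mx_nneg : A \is a mxOver Num.nneg;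
  Hd_homogeneous : forall (alpha : 'cV[R]_d) (x : pvec n),
    alpha \is a mxOver Num.nneg -> Kplus x ->
    F (scale alpha x) = scale (mxpow alpha A) (F x);
  Hd_order_preserving : forall x y, Kplus x -> Kplus y ->
    leK x y -> leK (F x) (F y);
  Hd_pos : forall x, Kpos x -> Kpos (F x);
  Hd_mx_pos : forall v : 'cV[R]_d,
    v \is a mxOver Num.pos -> A *m v \is a mxOver Num.pos
}.

Record is_norm (k : nat) (g : 'cV[R]_k -> R) : Prop := IsNorm {
  norm_triangle : forall x y, g (x + y) <= g x + g y;
  norm_scale : forall (a : R) x, g (a *: x) = `|a| * g x;
  norm_eq0 : forall x, g x = 0 -> x = 0
}.

Definition monotonic (k : nat) (g : 'cV[R]_k -> R) : Prop :=
  forall x y : 'cV[R]_k, (forall j, `|x j 0| <= `|y j 0|) -> g x <= g y.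

Definition Splus (gamma : forall i, 'cV[R]_(n i) -> R) : set (pvec n) :=
  [set x | Kplus x /\ forall i, gamma i (x i) = 1].

(* The supremum is taken in the extended reals, so that no boundedness is
   presupposed. *)
Definition spectral_radius (gamma : forall i, 'cV[R]_(n i) -> R)
    (b : 'cV[R]_d) (F : pvec n -> pvec n) : \bar R :=
  ereal_sup [set r | exists (x : pvec n) (lambda : 'cV[R]_d),
    [/\ Splus gamma x, lambda \is a mxOver Num.nneg, F x = scale lambda x &
        r = (\prod_i (lambda i 0) `^ (b i 0))%:E]].

(* At m = 0 the exponents b_i / m are 0 by the convention x / 0 = 0; this is
   irrelevant for limits as m tends to infinity. *)
Definition growth (gamma : forall i, 'cV[R]_(n i) -> R) (b : 'cV[R]_d)
    (F : pvec n -> pvec n) (x : pvec n) (m : nat) : \bar R :=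
  (\prod_i (gamma i (iter m F x i)) `^ (b i 0 / m%:R))%:E.

End MultiHomogeneous.

Arguments pvec R {d} n.

(* Main.v *)
Require Import Defs.
From mathcomp Require Import all_boot all_order all_algebra.
From mathcomp Require Import all_classical all_reals all_analysis.
From mathcomp Require Import ring lra.
Import Order.TTheory GRing.Theory Num.Theory.
Import numFieldNormedType.Exports.
Local Open Scope classical_set_scope.
Local Open Scope ring_scope.

(** For e > 0 the entrywise (1 + e)-th root of F is a strict contraction for a
    Hilbert-type metric weighted by b, because A^T b = b. Its nearly fixed points
    x_e are positive and satisfy F_ij(x_e) / x_ij^(1+e) = const in j up to a
    factor exp(e). A limit u of the x_e along an ultrafilter is an eigenvector,
    F(u) = lambda u, and the x_e themselves are positive vectors v with
    F(v) <= (lambda + s) v for s arbitrarily small. Since wprod b is invariant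
    under alpha |-> alpha^A, dominating any x by a multiple of v bounds the
    weighted product of the norms of F^m(x) by a constant times
    wprod b (lambda + s)^m. Hence no growth rate, and no eigenvalue, exceeds
    wprod b lambda, which is the growth rate of u at every m > 0. *)

(** * Real powers of products and weighted products *)

Section PowR.
Local Set Implicit Arguments.
Local Unset Strict Implicit.
Context {R : realType}.

Lemma powR_prod (I : finType) (f : I -> R) (r : R) :
  (forall i, 0 <= f i) -> (\prod_i f i) `^ r = \prod_i (f i) `^ r.
Proof.
move=> f0; suff [] : 0 <= \prod_i f i /\ (\prod_i f i) `^ r = \prod_i (f i) `^ r by [].
elim/big_rec2: _ => [|i y x _ [x0 xy]]; first by rewrite powR1.
by split; [exact: mulr_ge0 | rewrite powRM// xy].
Qed.

(** Nonnegative exponents make the rule hold even for [a = 0]: a zero exponent is split off as a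
    factor 1, and otherwise the total exponent is nonzero. *)
Lemma powR_sum (I : finType) (a : R) (r : I -> R) :
  (forall i, 0 <= r i) -> a `^ (\sum_i r i) = \prod_i a `^ r i.
Proof.
move=> r0; suff [] : 0 <= \sum_i r i /\ a `^ (\sum_i r i) = \prod_i a `^ r i by [].
elim/big_rec2: _ => [|i y x _ [x0 xy]]; first by rewrite powRr0.
have ri := r0 i; split; first exact: addr_ge0.
rewrite -xy; have [ri0|ri0] := eqVneq (r i) 0; first by rewrite ri0 add0r powRr0 mul1r.
by rewrite powRD//; apply/implyP => /eqP; move/eqP: ri0; lra.
Qed.

Context {d : nat}.
Implicit Types (b u v : 'cV[R]_d) (A : 'M[R]_d).

Definition wprod b v : R := \prod_i (v i 0) `^ (b i 0).

Definition hadamard u v : 'cV[R]_d := \col_i (u i 0 * v i 0).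

Lemma wprod_ge0 b v : 0 <= wprod b v.
Proof. by apply: prodr_ge0 => i _; exact: powR_ge0. Qed.

Lemma wprodM b u v : (forall i, 0 <= u i 0) -> (forall i, 0 <= v i 0) ->
  wprod b (hadamard u v) = wprod b u * wprod b v.
Proof.
move=> u0 v0; rewrite /wprod -big_split /=; apply: eq_bigr => i _.
by rewrite mxE powRM.
Qed.

Lemma ler_wprod b u v : (forall i, 0 <= b i 0) -> (forall i, 0 <= u i 0) ->
  (forall i, u i 0 <= v i 0) -> wprod b u <= wprod b v.
Proof.
move=> b0 u0 uv; apply: ler_prod => i _; rewrite powR_ge0 /=.
by apply: ge0_ler_powR => //; rewrite nnegrE// (le_trans (u0 i)).
Qed.

Lemma mxpow_ge0 (a : 'cV[R]_d) A i : 0 <= mxpow a A i 0.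
Proof. by rewrite mxE; apply: prodr_ge0 => k _; exact: powR_ge0. Qed.

(** After the two products are exchanged, [a k 0] carries the exponent sum_i A_ik b_i, the k-th
    entry of A^T b, which is b_k. *)
Lemma wprod_mxpow b A (a : 'cV[R]_d) : (forall i, 0 <= b i 0) ->
  (forall i k, 0 <= A i k) -> A^T *m b = b ->
  wprod b (mxpow a A) = wprod b a.
Proof.
move=> b0 A0 Ab; rewrite /wprod.
under eq_bigr => i _.
  rewrite mxE powR_prod; last by move=> k; exact: powR_ge0.
  under eq_bigr do rewrite -powRrM.
  over.
rewrite exchange_big /=; apply: eq_bigr => k _.
rewrite -powR_sum; last by move=> i; exact: mulr_ge0.
congr (_ `^ _); rewrite -{2}Ab mxE; apply: eq_bigr => i _.
by rewrite mxE.
Qed.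

End PowR.

(** * The cone and its order in coordinates *)

Section Cone.
Local Set Implicit Arguments.
Local Unset Strict Implicit.
Context {R : realType} {d : nat} {n : 'I_d -> nat}.
Implicit Types x y : pvec R n.

Lemma KplusP x : Kplus x <-> forall i j, 0 <= x i j 0.
Proof.
split=> [xK i j|xK i]; first by have /mxOverP/(_ j 0) := xK i; rewrite nnegrE.
by apply/mxOverP => j k; rewrite ord1 nnegrE.
Qed.

Lemma KposP x : Kpos x <-> forall i j, 0 < x i j 0.
Proof.
split=> [xK i j|xK i]; first by have /mxOverP/(_ j 0) := xK i; rewrite posrE.
by apply/mxOverP => j k; rewrite ord1 posrE.
Qed.

Lemma Kpos_Kplus x : Kpos x -> Kplus x.
Proof. by move/KposP => xK; apply/KplusP => i j; exact/ltW. Qed.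

Lemma leKP x y : leK x y <-> forall i j, x i j 0 <= y i j 0.
Proof.
rewrite /leK; split => [/KplusP xy i j|xy]; last apply/KplusP => i j.
  by have := xy i j; rewrite !mxE subr_ge0.
by rewrite !mxE subr_ge0.
Qed.

Lemma scaleE (a : 'cV[R]_d) x i j : scale a x i j 0 = a i 0 * x i j 0.
Proof. by rewrite /scale mxE. Qed.

Lemma scale_hadamard (u v : 'cV[R]_d) x : scale u (scale v x) = scale (hadamard u v) x.
Proof. by apply/functional_extensionality_dep => i; rewrite /scale scalerA mxE. Qed.

End Cone.

(** * Contraction and approximate eigenvectors *)

Section Approximation.
Local Set Implicit Arguments.
Local Unset Strict Implicit.
Context {R : realType} {d : nat} {n : 'I_d -> nat}.
Context (F : pvec R n -> pvec R n) (A : 'M[R]_d) (F_Hd : in_Hd F A).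
Implicit Types (x y : pvec R n) (s b : 'cV[R]_d) (p : R).

Lemma Hd_mx_ge0 i k : 0 <= A i k.
Proof. by have /mxOverP/(_ i k) := Hd_mx_nneg F_Hd; rewrite nnegrE. Qed.

Lemma Hd_scale s x : (forall i, 0 <= s i 0) -> Kplus x ->
  F (scale s x) = scale (mxpow s A) (F x).
Proof.
move=> s0 xK; apply: (Hd_homogeneous F_Hd) => //.
by apply/mxOverP => i j; rewrite ord1 nnegrE.
Qed.

Lemma Hd_le x y : Kplus x -> (forall i j, x i j 0 <= y i j 0) ->
  forall i j, F x i j 0 <= F y i j 0.
Proof.
move=> /[dup] xK /KplusP x0 xy; apply/leKP; apply: (Hd_order_preserving F_Hd) => //.
  by apply/KplusP => i j; exact: le_trans (x0 i j) (xy i j).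
exact/leKP.
Qed.

(** For positive vectors this says |ln x_ij - ln y_ij| <= s_i: a Hilbert-type distance with one
    radius per block, so that [A] can act linearly on the radii. *)
Definition close s x y := forall i j,
  x i j 0 <= expR (s i 0) * y i j 0 /\ y i j 0 <= expR (s i 0) * x i j 0.

Definition rootmap p x : pvec R n := fun i => \col_j (F x i j 0) `^ p.

Lemma rootmapE p x i j : rootmap p x i j 0 = (F x i j 0) `^ p.
Proof. by rewrite /rootmap mxE. Qed.

Lemma rootmap_pos p x : Kpos x -> Kpos (rootmap p x).
Proof.
move=> /(Hd_pos F_Hd)/KposP xK; apply/KposP => i j.
by rewrite rootmapE powR_gt0.
Qed.

(** Order preservation and homogeneity turn x <= exp(s) y into F(x) <= exp(s)^A F(y), and exp(s)^A =
    exp(A s); the root then multiplies the exponent by [p]. *)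
Lemma le_rootmap p s x y : 0 <= p -> Kpos x -> Kpos y ->
  (forall i j, x i j 0 <= expR (s i 0) * y i j 0) ->
  forall i j, rootmap p x i j 0 <= expR ((p *: (A *m s)) i 0) * rootmap p y i j 0.
Proof.
move=> p0 xK yK xy i j.
pose e : 'cV[R]_d := \col_i expR (s i 0).
have e0 k : 0 <= e k 0 by rewrite mxE expR_ge0.
have := @Hd_le x (scale e y) (Kpos_Kplus xK).
rewrite Hd_scale//; last exact: Kpos_Kplus.
have xey k l : x k l 0 <= scale e y k l 0 by rewrite scaleE mxE.
move=> /(_ xey i j); rewrite scaleE !rootmapE => le1.
have F0 z : Kpos z -> 0 <= F z i j 0.
  by move=> /(Hd_pos F_Hd)/KposP zK; exact/ltW.
apply: le_trans (ge0_ler_powR p0 _ _ le1) _; rewrite ?nnegrE ?F0//.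
  by rewrite mulr_ge0 ?F0 ?mxpow_ge0.
rewrite powRM ?F0 ?mxpow_ge0// ler_wpM2r ?powR_ge0//.
have -> : (p *: (A *m s)) i 0 = (A *m s) i 0 * p by rewrite mxE mulrC.
rewrite expRM le_eqVlt; apply/orP; left; apply/eqP; congr (_ `^ _).
rewrite !mxE expR_sum; apply: eq_bigr => k _.
by rewrite mxE mulrC expRM.
Qed.

Lemma close_rootmap p s x y : 0 <= p -> Kpos x -> Kpos y -> close s x y ->
  close (p *: (A *m s)) (rootmap p x) (rootmap p y).
Proof.
move=> p0 xK yK sxy i j; split; apply: le_rootmap => // k l.
  by have [] := sxy k l.
by have [] := sxy k l.
Qed.

Lemma close_pos x y : Kpos x -> Kpos y ->
  exists2 s : 'cV[R]_d, (forall i, 0 <= s i 0) & close s x y.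
Proof.
move=> /KposP x0 /KposP y0.
pose f i j := `|ln (x i j 0) - ln (y i j 0)|.
exists (\col_i \sum_j f i j) => [i|i j].
  by rewrite mxE sumr_ge0// => j _; exact: normr_ge0.
have : f i j <= \sum_j f i j.
  by rewrite (bigD1 j)//= lerDl sumr_ge0// => l _; exact: normr_ge0.
rewrite mxE; move: (\sum_j _) => t; rewrite /f ler_norml => /andP[le1 le2].
rewrite -[X in X <= _ /\ _ <= _ * X](lnK (x0 i j)) -[X in _ <= _ * X /\ _](lnK (y0 i j)).
rewrite -[X in _ /\ X <= _](lnK (y0 i j)) -!expRD !ler_expR; split; lra.
Qed.

(* One step of rootmap multiplies the b-weighted sum of the closeness exponents
   by p, because b is a left eigenvector of A; iterating from any positive point
   therefore contracts. *)
Lemma approx_fixpoint b p e : (forall i, 0 < b i 0) -> A^T *m b = b ->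
  0 <= p < 1 -> 0 < e ->
  exists2 x, Kpos x & close (const_mx e) x (rootmap p x).
Proof.
move=> b0 Ab /andP[p0 p1] e0.
pose x0 : pvec R n := fun=> const_mx 1.
have x0K : Kpos x0 by apply/KposP => i j; rewrite mxE.
have [s s0 sx0] := close_pos x0K (rootmap_pos p x0K).
pose x k := iter k (rootmap p) x0.
pose t k : 'cV[R]_d := iter k (fun s => p *: (A *m s)) s.
have xK k : Kpos (x k) by elim: k => //= k; exact: rootmap_pos.
have xt k : close (t k) (x k) (rootmap p (x k)).
  elim: k => //= k IH; apply: close_rootmap => //; exact: rootmap_pos.
have t0 k i : 0 <= t k i 0.
  elim: k i => //= k IH i; rewrite 2!mxE mulr_ge0// sumr_ge0// => j _.
  by rewrite mulr_ge0// Hd_mx_ge0.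
have tb k : b^T *m t k = p ^+ k *: (b^T *m s).
  elim: k => [|k IH]; first by rewrite expr0 scale1r.
  have /(congr1 trmx) := Ab; rewrite trmx_mul trmxK => bA.
  by rewrite /= -/(t k) -scalemxAr mulmxA bA IH scalerA exprS.
pose B := (b^T *m s) 0 0.
have bt k i : b i 0 * t k i 0 <= p ^+ k * B.
  have <- : (b^T *m t k) 0 0 = p ^+ k * B by rewrite tb mxE.
  rewrite mxE (bigD1 i)//= mxE lerDl sumr_ge0// => j _.
  by rewrite mxE mulr_ge0// ltW.
have : \forall k \near \oo, forall i, p ^+ k * B < b i 0 * e.
  apply: filter_forall => i; apply: (cvgr_lt (0 * B)); last by rewrite mul0r mulr_gt0.
  by apply: cvgMl; apply: cvg_expr; rewrite ger0_norm.
case=> k _ /(_ k (leqnn k)) ke; exists (x k) => // i j.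
have te : t k i 0 <= e.
  by rewrite -(ler_pM2l (b0 i)); exact: le_trans (bt k i) (ltW (ke i)).
have [le1 le2] := xt k i j; rewrite mxE.
by split; [apply: le_trans le1 _|apply: le_trans le2 _]; apply: ler_wpM2r;
  rewrite ?ler_expR// ltW//; [have /KposP := rootmap_pos p (xK k)|have /KposP := xK k].
Qed.

(* A fixed point of rootmap (1 + e)^-1 would satisfy F x i j 0 = x i j 0 `^ (1 + e). *)
Lemma approx_eigenvector b e : (forall i, 0 < b i 0) -> A^T *m b = b -> 0 < e ->
  exists2 x, Kpos x & forall i j l,
    F x i j 0 * x i l 0 `^ (1 + e) <= expR e * (F x i l 0 * x i j 0 `^ (1 + e)).
Proof.
move=> b0 Ab e0.
have e1 : 0 < 1 + e by lra.
pose p := (1 + e)^-1.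
have p01 : 0 <= p < 1 by rewrite invr_ge0 ltW//= invf_lt1; lra.
(* Raising to the power 1 + e turns this tolerance into a factor exp(e / 2), paid once for [j] and
   once for [l]. *)
have [|x xK xp] := @approx_fixpoint b p (e / 2 / (1 + e)) b0 Ab p01.
  by rewrite divr_gt0// divr_gt0.
exists x => // i j l; set q := 1 + e.
have x0 k : 0 < x i k 0 by have /KposP := xK.
have F0 k : 0 < F x i k 0 by have /KposP := Hd_pos F_Hd xK.
have FE k : F x i k 0 = rootmap p x i k 0 `^ q.
  by rewrite rootmapE -powRrM mulVf ?powRr1 ?ltW ?gt_eqF.
have r0 k : 0 <= rootmap p x i k 0 by rewrite rootmapE powR_ge0.
have eq2 : expR (e / 2 / q) `^ q = expR (e / 2).
  by rewrite -expRM divfK// gt_eqF.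
have le1 : F x i j 0 <= expR (e / 2) * x i j 0 `^ q.
  rewrite FE -eq2 -powRM ?expR_ge0 ?(ltW (x0 _))//.
  apply: ge0_ler_powR; rewrite ?nnegrE ?mulr_ge0 ?expR_ge0 ?(ltW e1) ?(ltW (x0 _))//.
  by have [] := xp i j; rewrite mxE.
have le2 : x i l 0 `^ q <= expR (e / 2) * F x i l 0.
  rewrite FE -eq2 -powRM ?expR_ge0//.
  apply: ge0_ler_powR; rewrite ?nnegrE ?mulr_ge0 ?expR_ge0 ?(ltW e1) ?(ltW (x0 _))//.
  by have [] := xp i l; rewrite mxE.
apply: le_trans (ler_pM _ _ le1 le2) _; rewrite ?powR_ge0 ?(ltW (F0 _))//.
have -> : expR e = expR (e / 2) * expR (e / 2) by rewrite -expRD -splitr.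
rewrite le_eqVlt; apply/orP; left; apply/eqP; ring.
Qed.

End Approximation.

(** * Limits of powers and convergence in the product space *)

Section Continuity.
Local Set Implicit Arguments.
Local Unset Strict Implicit.
Context {R : realType}.

(** At [a = 0] the power need not be differentiable, so this point is treated apart; the right-hand
    limit keeps the base nonnegative. *)
Lemma cvg_powR_addr (a p : R) : 0 <= a -> 0 < p ->
  (a + s) `^ p @[s --> 0^'+] --> a `^ p.
Proof.
rewrite le_eqVlt => /orP[/eqP<- p0|a0 p0].
  under eq_fun do rewrite add0r.
  by rewrite powR0 ?gt_eqF//; exact: powR_cvg0.
have cp : {for a, continuous (fun x : R => x `^ p)}.
  apply: differentiable_continuous; apply/derivable1_diffP.
  by apply: derivable_powR; rewrite in_itv/= a0.
have a_cvg : a + s @[s --> 0^'+] --> a + 0.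
  apply: cvgD; first exact: cvg_cst.
  exact: cvg_at_right_filter.
rewrite addr0 in a_cvg.
exact: (@cvg_comp _ _ _ (fun s => a + s) (fun x : R => x `^ p) _ (nbhs a)).
Qed.

Lemma lt_wprod_addr d (b v : 'cV[R]_d) (e : R) : (forall i, 0 < b i 0) ->
  (forall i, 0 <= v i 0) -> wprod b v < e ->
  exists2 s : R, 0 < s & wprod b (\col_i (v i 0 + s)) < e.
Proof.
move=> b0 v0 ve.
have : wprod b (\col_i (v i 0 + s)) @[s --> 0^'+] --> wprod b v.
  under eq_fun do (rewrite /wprod; under eq_bigr do rewrite mxE).
  apply: cvg_big => [|i _]; first exact: (@mul_continuous R).
  exact: cvg_powR_addr.
move=> /cvgr_lt/(_ _ ve) H.
have [s [s0 se]] := filter_ex (filterI (nbhs_right_gt (0 : R)) H).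
by exists s.
Qed.

Lemma cvg_prod_topology (I : eqType) (K : I -> topologicalType)
    (G : set_system (prod_topology K)) (f : prod_topology K) : Filter G ->
  (forall i, (g i @[g --> G]) --> f i) -> G --> f.
Proof.
move=> FG Gf; apply/cvg_sup => i B /= [_ [[C oC <-] Cf] sCB].
by apply: (@filterS _ G FG _ _ sCB); exact: Gf (open_nbhs_nbhs (conj oC Cf)).
Qed.

Lemma cvg_mx (m n : nat) (G : set_system 'M[R]_(m, n)) (M : 'M[R]_(m, n)) :
  Filter G -> (forall i j, N i j @[N --> G] --> M i j) -> G --> M.
Proof.
move=> FG GM; apply/cvg_mx_entourageP => B eB.
apply: filter_forall => i; apply: filter_forall => j.
have nB : nbhs (M i j) (xsection B (M i j)) by rewrite -nbhs_entourageE; exists B.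
apply: (@filterS _ G FG _ _ _ (GM i j _ nB)) => N.
by rewrite /xsection /= inE.
Qed.

Lemma cvg_pvec d (n : 'I_d -> nat) (G : set_system (pvec R n)) (u : pvec R n) :
  Filter G ->
  (forall i j, (x : pvec R n) i j 0 @[x --> G] --> u i j 0) <-> G --> u.
Proof.
move=> FG; split => [Gu|Gu i j].
  apply: cvg_prod_topology => i; apply: cvg_mx => j k.
  by rewrite ord1; exact: Gu.
apply: (@cvg_comp _ _ _ (fun x : pvec R n => x i)
  (fun M : 'cV[R]_(n i) => M j 0) G (nbhs (u i))); last exact: coord_continuous.
apply: (@cvg_comp _ _ _ id (@proj _ (fun i => 'cV[R]_(n i)) i) G (nbhs u)) => //.
exact: (@proj_continuous _ (fun i => 'cV[R]_(n i)) i u).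
Qed.

End Continuity.

(** Cancelling t^e leaves the factor (s / t)^e <= exp(e c), which tends to 1 as e -> 0 while c stays
    fixed. In the limit this compares the ratios f / s and g / t. *)
Lemma ratio_bound {R : realType} (e c f g s t : R) :
  0 < e -> 0 < s -> 0 < t -> 0 <= g ->
  f * t `^ (1 + e) <= expR e * (g * s `^ (1 + e)) ->
  s <= expR c * t -> f * t <= expR (e * (1 + c)) * (g * s).
Proof.
move=> e0 s0 t0 g0.
have sp r : 0 < r -> r `^ (1 + e) = r * r `^ e.
  move=> r0; rewrite powRD ?powRr1 ?ltW//.
  by apply/implyP => _; rewrite gt_eqF.
rewrite !sp// => H st.
have te : 0 < t `^ e by exact: powR_gt0.
have le1 : s `^ e <= expR (e * c) * t `^ e.
  rewrite [e * c]mulrC expRM -powRM ?expR_ge0 ?(ltW t0)//.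
  by apply: ge0_ler_powR; rewrite ?nnegrE ?(ltW e0) ?(ltW s0) ?mulr_ge0 ?expR_ge0 ?(ltW t0).
rewrite -(ler_pM2r te).
have -> : f * t * t `^ e = f * (t * t `^ e) by rewrite mulrA.
apply: le_trans H _.
rewrite mulrDr mulr1 expRD.
have -> : expR e * expR (e * c) * (g * s) * t `^ e =
  expR e * (g * (s * (expR (e * c) * t `^ e))) by ring.
by rewrite !ler_wpM2l ?expR_ge0 ?(ltW s0).
Qed.

(** [G] contains the preimage of [B] or its complement; the latter would put both [B] and its
    complement into the proper filter [H]. *)
Lemma ultra_fmap {T U : Type} (f : T -> U) {G : set_system T} :
  UltraFilter G -> UltraFilter (f @ G).
Proof.
move=> GU; split => [|H HP GH]; first by apply: fmap_proper_filter; exact: ultra_proper.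
rewrite eqEsubset; split => // B HB.
have [//|GB] := in_ultra_setVsetC (f @^-1` B) GU.
have /GH HC : (f @ G) (~` B) by [].
have HI : H (B `&` ~` B) by exact: filterI.
by have [x []] := filter_ex HI.
Qed.

(** * An eigenvector as an ultrafilter limit *)

Section LimitEigenvector.
Local Set Implicit Arguments.
Local Unset Strict Implicit.
Context {R : realType} {d : nat} {n : 'I_d -> nat}.
Context (n_gt0 : forall i, (0 < n i)%N).
Context (F : pvec R n -> pvec R n) (A : 'M[R]_d) (F_Hd : in_Hd F A).
Context (b : 'cV[R]_d) (b_gt0 : forall i, 0 < b i 0) (b_eigen : A^T *m b = b).
Implicit Types x : pvec R n.

(** Unit block sums confine the points to a compact box and keep every block of their limit
    nonzero. *)
Lemma approx_eigenvector_normalized e : 0 < e ->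
  exists x, [/\ Kpos x, forall i, \sum_j x i j 0 = 1 & forall i j l,
    F x i j 0 * x i l 0 `^ (1 + e) <= expR e * (F x i l 0 * x i j 0 `^ (1 + e))].
Proof.
move=> e0; have [x /[dup] xK /KposP x0 xe] := approx_eigenvector F_Hd b_gt0 b_eigen e0.
pose a : 'cV[R]_d := \col_i (\sum_j x i j 0)^-1.
have s0 i : 0 < \sum_j x i j 0.
  rewrite (bigD1 (Ordinal (n_gt0 i)))//= ltr_pwDl// sumr_ge0// => j _; exact: ltW.
have a0 i : 0 < a i 0 by rewrite mxE invr_gt0.
exists (scale a x); split => [|i|i j l].
- by apply/KposP => i j; rewrite scaleE mulr_gt0.
- under eq_bigr do rewrite scaleE.
  by rewrite -mulr_sumr mxE mulVf// gt_eqF.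
rewrite (Hd_scale F_Hd); [|by move=> k; exact: ltW|exact: Kpos_Kplus].
rewrite !scaleE !powRM ?(ltW (a0 _)) ?(ltW (x0 _ _))//.
(* Rescaling multiplies both sides by the same m q, since the scaling factors depend only on the
   block [i]. *)
set m := mxpow a A i 0; set q := _ `^ _.
have -> : m * F x i j 0 * (q * x i l 0 `^ (1 + e)) =
  (m * q) * (F x i j 0 * x i l 0 `^ (1 + e)) by ring.
have -> : expR e * (m * F x i l 0 * (q * x i j 0 `^ (1 + e))) =
  (m * q) * (expR e * (F x i l 0 * x i j 0 `^ (1 + e))) by ring.
by rewrite ler_wpM2l// mulr_ge0 ?powR_ge0 ?mxpow_ge0.
Qed.

(** [u] may lie on the boundary of the cone, where its multiples do not dominate every vector; the
    last clause provides interior vectors [v] whose multiples do. *)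
Lemma limit_eigenvector : exists (u : pvec R n) (lambda : 'cV[R]_d),
  [/\ Kplus0 u, forall i, 0 <= lambda i 0, F u = scale lambda u &
   forall s, 0 < s -> exists2 v, Kpos v &
     forall i j, F v i j 0 <= (lambda i 0 + s) * v i j 0].
Proof.
have h0 k : 0 < harmonic k :> R by rewrite invr_gt0.
have /choice[x xP] : forall k : nat, exists x, [/\ Kpos x, forall i, \sum_j x i j 0 = 1 &
    forall i j l, F x i j 0 * x i l 0 `^ (1 + harmonic k) <=
       expR (harmonic k) * (F x i l 0 * x i j 0 `^ (1 + harmonic k))].
  by move=> k; exact: approx_eigenvector_normalized.
have xK k : Kpos (x k) by have [] := xP k.
have x_gt0 k i j : 0 < x k i j 0 by have /KposP := xK k.
have F_gt0 k i j : 0 < F (x k) i j 0 by have /KposP := Hd_pos F_Hd (xK k).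
have x_le1 k i j : x k i j 0 <= 1.
  have [_ /(_ i) <- _] := xP k.
  by rewrite (bigD1 j)//= lerDl sumr_ge0// => l _; exact: ltW.
(* Along an ultrafilter finer than the tails every bounded coordinate converges, so no subsequences
   are extracted. *)
have [G [GU subG]] := ultraFilterLemma (eventually_filter).
have GP : ProperFilter G by exact: ultra_proper.
have uP i j : exists w : R, x k i j 0 @[k --> G] --> w.
  have GxU := ultra_fmap (fun k => x k i j 0) GU.
  have cpt : compact `[0 : R, 1]%classic by exact: segment_compact.
  rewrite compact_ultra in cpt; have [|w [_ Gw]] := cpt _ GxU.
    by apply: (@filterE _ G _) => k; rewrite /= in_itv/= x_le1 ltW.
  by exists w.
pose u : pvec R n := fun i => \col_j sval (cid (uP i j)).
have xu i j : x k i j 0 @[k --> G] --> u i j 0.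
  by rewrite /u mxE; case: cid.
have u_ge0 i j : 0 <= u i j 0.
  apply: (ler_cvg_to (cvg_cst 0) (xu i j)); apply: nearW => k; exact: ltW.
have uK : Kplus u by apply/KplusP.
have Gx : x @ G --> u by apply/cvg_pvec.
have FGx : F \o x @ G --> F u.
  have /subspace_continuousP/(_ u uK) := Hd_continuous F_Hd.
  apply: cvg_trans => B /= /Gx GB.
  apply: (@filterS _ G _ _ _ _ GB) => k /=; apply; exact: Kpos_Kplus.
have Fxu i j : F (x k) i j 0 @[k --> G] --> F u i j 0.
  by have /cvg_pvec/(_ i j) := FGx.
have Fu_ge0 i j : 0 <= F u i j 0 by have /KplusP := Hd_maps F_Hd uK.
have h_cvg : harmonic k @[k --> G] --> (0 : R).
  by move=> B /cvg_harmonic/subG.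
have ratio i l : 0 < u i l 0 -> exists c : R, \forall k \near G, forall j,
    F (x k) i j 0 * x k i l 0 <=
    expR (harmonic k * (1 + c)) * (F (x k) i l 0 * x k i j 0).
  (* Eventually x_il > u_il / 2, while x_ij <= 1, so x_ij / x_il <= 2 / u_il, a bound independent of
     k. *)
  move=> ul; exists (ln (2 / u i l 0)).
  have ul2 : u i l 0 / 2 < u i l 0 by lra.
  apply: (@filterS _ G _ _ _ _ (cvgr_gt _ (xu i l) _ ul2)) => k xl j.
  have [_ _ /(_ i j l) xe] := xP k.
  apply: ratio_bound xe _ => //; first exact: ltW.
  rewrite lnK ?posrE ?divr_gt0//; apply: le_trans (x_le1 k i j) _.
  by rewrite -mulrA mulrC -mulrA ler_pdivlMl//; lra.
have e_cvg (c : R) : expR (harmonic k * (1 + c)) @[k --> G] --> (1 : R).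
  apply: (@cvg_comp _ _ _ (fun k => harmonic k * (1 + c)) expR _ (nbhs 0)).
    by rewrite -(mul0r (1 + c)); exact: cvgMl.
  by rewrite -expR0; exact: continuous_expR.
have Fu_le i j l : 0 < u i l 0 -> F u i j 0 * u i l 0 <= F u i l 0 * u i j 0.
  move=> ul; have [c cP] := ratio i l ul.
  rewrite -[X in _ <= X]mul1r.
  apply: (ler_cvg_to (cvgM (Fxu i j) (xu i l)) (cvgM (e_cvg c) (cvgM (Fxu i l) (xu i j)))).
  by apply: (@filterS _ G _ _ _ _ cP) => k; exact.
have u_pos i : exists l, 0 < u i l 0.
  have : \sum_j u i j 0 = 1.
    have : \sum_j x k i j 0 @[k --> G] --> \sum_j u i j 0.
      by apply: cvg_big => [|j _]; [exact: (@add_continuous R)|exact: xu].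
    have -> : (fun k => \sum_j x k i j 0) = cst 1.
      by apply/funext => k; have [_ ->] := xP k.
    by move=> H; exact: (cvg_unique _ H (cvg_cst _)).
  move=> u1; apply: contrapT => /forallNP un.
  have : \sum_j u i j 0 = 0.
    apply: big1 => j _; apply/eqP; rewrite eq_le u_ge0 andbT leNgt; exact/negP.
  by rewrite u1 => /eqP; rewrite oner_eq0.
pose l i := sval (cid (u_pos i)).
have u_gt0 i : 0 < u i (l i) 0 by exact: svalP (cid (u_pos i)).
pose lambda : 'cV[R]_d := \col_i (F u i (l i) 0 / u i (l i) 0).
exists u, lambda; split.
- by split=> // i; apply/eqP => ui; have := u_gt0 i; rewrite ui mxE ltxx.
- by move=> i; rewrite mxE divr_ge0.
- apply/functional_extensionality_dep => i; apply/matrixP => j k.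
  rewrite ord1 scaleE [lambda i 0]mxE mulrAC.
  (* Cross-multiplied, the eigenvalue equation is [Fu_le] in both directions; where u_ij = 0 the
     reverse direction is trivial. *)
  apply: (canRL (mulfK (lt0r_neq0 (u_gt0 i)))); apply/le_anti; rewrite Fu_le//=.
  have [uj|uj] := ltP 0 (u i j 0); first exact: Fu_le.
  have -> : u i j 0 = 0 by apply/le_anti; rewrite uj u_ge0.
  by rewrite mulr0 mulr_ge0.
move=> s s0.
have /choice[c cP] : forall i, exists c : R, \forall k \near G, forall j,
    F (x k) i j 0 * x k i (l i) 0 <=
    expR (harmonic k * (1 + c)) * (F (x k) i (l i) 0 * x k i j 0).
  by move=> i; exact: ratio.
(* The upper bound for F_ij / x_ij tends to lambda_i < lambda_i + s, so the approximants themselves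
   eventually serve as [v]. *)
have : \forall k \near G, forall i j, F (x k) i j 0 <= (lambda i 0 + s) * x k i j 0.
  apply: filter_forall => i.
  have : expR (harmonic k * (1 + c i)) * (F (x k) i (l i) 0 / x k i (l i) 0) @[k --> G]
     --> 1 * lambda i 0.
    apply: cvgM (e_cvg _) _; rewrite mxE; apply: cvgM (Fxu _ _) _.
    by apply: cvgV (xu _ _); rewrite gt_eqF.
  rewrite mul1r => /cvgr_le/(_ (lambda i 0 + s)); rewrite ltrDl => /(_ s0) lP.
  apply: (@filterS2 _ G _ _ _ _ _ (cP i) lP) => k ck lk j.
  apply: (@le_trans _ _ (expR (harmonic k * (1 + c i)) * (F (x k) i (l i) 0 / x k i (l i) 0) * x k i j 0)); last first.
    by rewrite ler_wpM2r// ltW.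
  by rewrite -mulrA mulrAC mulrA ler_pdivlMr.
by move=> /filter_ex[k kP]; exists (x k).
Qed.

End LimitEigenvector.

(** * Growth rates of orbits *)

Section Growth.
Context {R : realType} {d : nat} {n : 'I_d -> nat}.
Context (gamma : forall i, 'cV[R]_(n i) -> R).
Context (gamma_norm : forall i, is_norm (gamma i)).
Context (gamma_mono : forall i, monotonic (gamma i)).
Context (F : pvec R n -> pvec R n) (A : 'M[R]_d) (F_Hd : in_Hd F A).
Context (b : 'cV[R]_d) (b_gt0 : forall i, 0 < b i 0) (b_eigen : A^T *m b = b).
Local Set Implicit Arguments.
Local Unset Strict Implicit.
Implicit Types (x y v : pvec R n) (t mu : 'cV[R]_d).

Local Notation b_ge0 := (fun i => ltW (b_gt0 i)).

Lemma gamma0 i : gamma i 0 = 0.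
Proof. by rewrite -(scale0r 0) (norm_scale (gamma_norm i)) normr0 mul0r. Qed.

Lemma gamma_ge0 i (z : 'cV[R]_(n i)) : 0 <= gamma i z.
Proof.
by rewrite -(gamma0 i); apply: gamma_mono => j; rewrite mxE normr0 normr_ge0.
Qed.

Lemma gamma_gt0 i (z : 'cV[R]_(n i)) : z != 0 -> 0 < gamma i z.
Proof.
move=> z0; rewrite lt_neqAle gamma_ge0 andbT eq_sym; apply: contra z0 => /eqP.
by move/(norm_eq0 (gamma_norm i)) => ->.
Qed.

Lemma le_gamma x y : Kplus x -> (forall i j, x i j 0 <= y i j 0) ->
  forall i, gamma i (x i) <= gamma i (y i).
Proof.
move=> /KplusP x0 xy i; apply: gamma_mono => j.
by rewrite !ger0_norm// (le_trans (x0 i j)).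
Qed.

Definition block_norms x : 'cV[R]_d := \col_i gamma i (x i).

Lemma block_norms_ge0 x i : 0 <= block_norms x i 0.
Proof. by rewrite mxE gamma_ge0. Qed.

Lemma block_norms_scale t x : (forall i, 0 <= t i 0) ->
  block_norms (scale t x) = hadamard t (block_norms x).
Proof.
move=> t0; apply/matrixP => i j; rewrite ord1 !mxE.
by rewrite (norm_scale (gamma_norm i)) ger0_norm.
Qed.

Lemma Splus_block_norms x : Splus gamma x -> block_norms x = const_mx 1.
Proof. by move=> [_ x1]; apply/matrixP => i j; rewrite !mxE x1. Qed.

Lemma wprod1 : wprod b (const_mx 1) = 1.
Proof. by apply: big1 => i _; rewrite mxE powR1. Qed.

Lemma growthE x m :
  growth gamma b F x m = (wprod b (block_norms (iter m F x)) `^ m%:R^-1)%:E.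
Proof.
congr (_%:E); rewrite powR_prod; last by move=> i; exact: powR_ge0.
by apply: eq_bigr => i _; rewrite mxE powRrM.
Qed.

Lemma iter_Kplus x m : Kplus x -> Kplus (iter m F x).
Proof. by move=> xK; elim: m => //= m; exact: (Hd_maps F_Hd). Qed.

(** If F(v) = mu v, this is the factor of F^m(t v): each step raises it to the power [A] by
    homogeneity and multiplies by [mu]. *)
Definition iter_factor mu t m : 'cV[R]_d :=
  iter m (fun s => hadamard (mxpow s A) mu) t.

Lemma iter_factor_ge0 mu t m : (forall i, 0 <= mu i 0) ->
  (forall i, 0 <= t i 0) -> forall i, 0 <= iter_factor mu t m i 0.
Proof. by move=> mu0 t0; case: m => //= m i; rewrite mxE mulr_ge0// mxpow_ge0. Qed.

(** [wprod b] is unchanged by the power [A], so each step contributes just one factor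
    [wprod b mu]. *)
Lemma wprod_iter_factor mu t m : (forall i, 0 <= mu i 0) ->
  (forall i, 0 <= t i 0) ->
  wprod b (iter_factor mu t m) = wprod b t * wprod b mu ^+ m.
Proof.
move=> mu0 t0; elim: m => [|m IH]; first by rewrite expr0 mulr1.
rewrite /= wprodM//; last by move=> i; exact: mxpow_ge0.
rewrite wprod_mxpow//; [|exact: b_ge0|exact: Hd_mx_ge0 F_Hd].
by rewrite -/(iter_factor mu t m) IH exprSr mulrA.
Qed.

Lemma iter_eigenvector mu x m : (forall i, 0 <= mu i 0) -> Kplus x ->
  F x = scale mu x -> iter m F x = scale (iter_factor mu (const_mx 1) m) x.
Proof.
move=> mu0 xK Fx; elim: m => [|m IH] /=.
  by apply/functional_extensionality_dep => i; rewrite /scale mxE scale1r.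
rewrite IH (Hd_scale F_Hd)// ?Fx ?scale_hadamard//.
by apply: iter_factor_ge0 => // i; rewrite mxE.
Qed.

(** The norms of [x] are 1, so the root undoes the power of [wprod b mu]. The index [m.+1] skips m =
    0, where the growth is 1 by convention. *)
Lemma growth_eigenvector mu x m : (forall i, 0 <= mu i 0) -> Splus gamma x ->
  F x = scale mu x -> growth gamma b F x m.+1 = (wprod b mu)%:E.
Proof.
move=> mu0 /[dup] xS [xK _] Fx; rewrite growthE (iter_eigenvector _ mu0)//.
have one_ge0 i : 0 <= (const_mx 1 : 'cV[R]_d) i 0 by rewrite mxE.
have it0 := @iter_factor_ge0 _ _ m.+1 mu0 one_ge0.
rewrite block_norms_scale// wprodM//; last exact: block_norms_ge0.
rewrite wprod_iter_factor// Splus_block_norms// wprod1 mul1r mulr1.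
by rewrite -powR_mulrn ?wprod_ge0// -powRrM mulfV ?powRr1 ?wprod_ge0.
Qed.

(** Order preservation carries the bound through [F], homogeneity takes the multiple out, and F(v)
    <= mu v closes the induction. *)
Lemma iter_le_scale mu t v x m : (forall i, 0 <= mu i 0) ->
  (forall i, 0 <= t i 0) -> Kplus v ->
  (forall i j, F v i j 0 <= mu i 0 * v i j 0) ->
  Kplus x -> (forall i j, x i j 0 <= t i 0 * v i j 0) ->
  forall i j, iter m F x i j 0 <= iter_factor mu t m i 0 * v i j 0.
Proof.
move=> mu0 t0 vK Fv xK xv; elim: m => //= m IH i j.
have it0 := @iter_factor_ge0 _ _ m mu0 t0.
have le1 k l : iter m F x k l 0 <= scale (iter_factor mu t m) v k l 0.
  by rewrite scaleE.
apply: le_trans (Hd_le F_Hd (iter_Kplus m xK) le1 j) _.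
rewrite (Hd_scale F_Hd)// scaleE [hadamard _ _ _ _]mxE -mulrA.
by rewrite ler_wpM2l// mxpow_ge0.
Qed.

Lemma le_wprod_iter mu t v x m : (forall i, 0 <= mu i 0) ->
  (forall i, 0 <= t i 0) -> Kplus v ->
  (forall i j, F v i j 0 <= mu i 0 * v i j 0) ->
  Kplus x -> (forall i j, x i j 0 <= t i 0 * v i j 0) ->
  wprod b (block_norms (iter m F x)) <=
    wprod b t * wprod b (block_norms v) * wprod b mu ^+ m.
Proof.
move=> mu0 t0 vK Fv xK xv; have it0 := @iter_factor_ge0 _ _ m mu0 t0.
rewrite mulrAC -wprod_iter_factor// -wprodM//; last exact: block_norms_ge0.
rewrite -block_norms_scale//; apply: ler_wprod.
- exact: b_ge0.
- exact: block_norms_ge0.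
move=> i; rewrite !mxE; apply: (@le_gamma _ (scale _ v)); first exact: iter_Kplus.
by move=> k l; rewrite scaleE; exact: iter_le_scale.
Qed.

(** K^(1/m) = exp(ln K / m) tends to 1, so constant factors do not affect growth rates. *)
Lemma cvg_powR_inv (K c : R) : 0 < K -> c * K `^ m%:R^-1 @[m --> \oo] --> c.
Proof.
move=> K0; rewrite -[X in _ --> X]mulr1; apply: cvgMr.
have inv_cvg : (m%:R^-1 : R) @[m --> \oo] --> (0 : R).
  by rewrite -cvg_shiftS; exact: cvg_harmonic.
under eq_fun do rewrite -{1}(lnK K0) -expRM.
apply: (@cvg_comp _ _ _ (fun m => ln K * m%:R^-1) expR _ (nbhs 0)).
  by rewrite -(mulr0 (ln K)); exact: cvgMr.
by rewrite -expR0; exact: continuous_expR.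
Qed.

(** The threshold on m is chosen before [x]; this uniformity is what permits a supremum over
    [Splus]. *)
Lemma growth_near_le mu v t (e : R) : (forall i, 0 < mu i 0) ->
  (forall i, 0 <= t i 0) -> Kplus v ->
  (forall i j, F v i j 0 <= mu i 0 * v i j 0) -> wprod b mu < e ->
  \forall m \near \oo, forall x, Kplus x ->
    (forall i j, x i j 0 <= t i 0 * v i j 0) ->
    (growth gamma b F x m <= e%:E)%E.
Proof.
move=> mu0 t0 vK Fv mue.
have mu_ge0 i : 0 <= mu i 0 by exact: ltW.
(* The summand 1 keeps [K] positive even when [t] has a zero entry. *)
pose K := 1 + wprod b t * wprod b (block_norms v).
have K0 : 0 < K by rewrite ltr_pwDl// mulr_ge0// wprod_ge0.
have /cvgr_le/(_ _ mue) Ke := @cvg_powR_inv K (wprod b mu) K0.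
have [N _ KN] := Ke; exists N.+1 => // m /= Nm x xK xv.
rewrite growthE lee_fin; apply: le_trans (KN m (ltnW Nm)).
have m0 : m%:R != 0 :> R by rewrite pnatr_eq0 -lt0n (leq_trans _ Nm).
have -> : wprod b mu = (wprod b mu ^+ m) `^ m%:R^-1.
  by rewrite -powR_mulrn ?wprod_ge0// -powRrM mulfV// powRr1// wprod_ge0.
rewrite -powRM ?exprn_ge0 ?wprod_ge0 ?(ltW K0)//.
apply: ge0_ler_powR; rewrite ?nnegrE ?invr_ge0 ?ler0n ?wprod_ge0//.
  by rewrite mulr_ge0 ?exprn_ge0 ?wprod_ge0 ?(ltW K0).
apply: le_trans (@le_wprod_iter mu t v x m _ _ _ _ _ _) _ => //.
by rewrite mulrC ler_wpM2l ?exprn_ge0 ?wprod_ge0// lerDr.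
Qed.

Lemma Kplus_bound v x : Kpos v -> Kplus x -> exists2 t : 'cV[R]_d,
  (forall i, 0 <= t i 0) & forall i j, x i j 0 <= t i 0 * v i j 0.
Proof.
move=> /KposP v0 /KplusP x0; exists (\col_i \sum_j x i j 0 / v i j 0) => [i|i j].
  by rewrite mxE sumr_ge0// => j _; rewrite divr_ge0// ltW.
rewrite mxE -ler_pdivrMr// (bigD1 j)//= lerDl sumr_ge0// => l _.
by rewrite divr_ge0// ltW.
Qed.

Lemma Splus_bound v : Kpos v -> exists2 t : 'cV[R]_d,
  (forall i, 0 <= t i 0) &
  forall x, Splus gamma x -> forall i j, x i j 0 <= t i 0 * v i j 0.
Proof.
(* By monotonicity, x_ij times the norm of the j-th basis vector is at most the norm of x_i, which
   is 1; so [w] dominates all of [Splus]. *)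
move=> vK; pose w : pvec R n := fun i => \col_j (gamma i (delta_mx j 0))^-1.
have wK : Kplus w by apply/KplusP => i j; rewrite mxE invr_ge0 gamma_ge0.
have [t t0 wt] := Kplus_bound vK wK; exists t => // x [/KplusP xK x1] i j.
apply: le_trans (wt i j); rewrite mxE.
have dj : delta_mx j 0 != 0 :> 'cV[R]_(n i).
  apply/eqP => /matrixP/(_ j 0); rewrite !mxE !eqxx => /eqP.
  by rewrite oner_eq0.
rewrite -div1r ler_pdivlMr ?gamma_gt0// -(ger0_norm (xK i j)).
rewrite -(norm_scale (gamma_norm i)) -(x1 i); apply: gamma_mono => k.
rewrite !mxE eqxx andbT; have [->|_] := eqVneq k j; first by rewrite mulr1.
by rewrite mulr0 normr0 normr_ge0.
Qed.

End Growth.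

(** * Normalization of the maximal eigenvector *)

Section SpectralRadius.
Context {R : realType} {d : nat} {n : 'I_d -> nat}.
Context (n_gt0 : forall i, (0 < n i)%N).
Context (gamma : forall i, 'cV[R]_(n i) -> R).
Context (gamma_norm : forall i, is_norm (gamma i)).
Context (gamma_mono : forall i, monotonic (gamma i)).
Context (F : pvec R n -> pvec R n) (A : 'M[R]_d) (F_Hd : in_Hd F A).
Context (b : 'cV[R]_d) (b_gt0 : forall i, 0 < b i 0) (b_eigen : A^T *m b = b).

Local Set Implicit Arguments.
Local Unset Strict Implicit.

Local Notation b_ge0 := (fun i => ltW (b_gt0 i)).

(** Rescaling to unit norms may change the eigenvalue but not its weighted product. The [mu] found
    is a perturbation of the unnormalized eigenvalue, so only the products are compared. *)
Lemma maximal_eigenvector : exists (u : pvec R n) (lambda : 'cV[R]_d),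
  [/\ Splus gamma u, forall i, 0 <= lambda i 0, F u = scale lambda u &
   forall e, wprod b lambda < e -> exists (v : pvec R n) (mu : 'cV[R]_d),
     [/\ Kpos v, forall i, 0 < mu i 0,
       forall i j, F v i j 0 <= mu i 0 * v i j 0 & wprod b mu < e]].
Proof.
have [w [nu [[wK w_neq0] nu0 Fw wv]]] := limit_eigenvector n_gt0 F_Hd b_gt0 b_eigen.
have gw0 i : 0 < gamma i (w i) by exact: gamma_gt0.
pose g := block_norms gamma w.
have g0 i : 0 < g i 0 by rewrite mxE.
pose a : 'cV[R]_d := \col_i (g i 0)^-1.
have a0 i : 0 < a i 0 by rewrite mxE invr_gt0.
have ga : hadamard a g = const_mx 1.
  by apply/matrixP => i j; rewrite ord1 !mxE mulVf// gt_eqF.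
(* Homogeneity produces a^A, and [g], the entrywise inverse of [a], restores [scale a w]; their
   weighted products cancel. *)
pose lambda := hadamard (hadamard (mxpow a A) nu) g.
have lambda0 i : 0 <= lambda i 0.
  by rewrite mxE mulr_ge0 ?(ltW (g0 i))// mxE mulr_ge0 ?mxpow_ge0.
have a_ge0 i : 0 <= a i 0 by exact: ltW.
have g_ge0 i : 0 <= g i 0 by exact: ltW.
have lambdaE : wprod b lambda = wprod b nu.
  rewrite wprodM//; last by move=> i; rewrite mxE mulr_ge0 ?mxpow_ge0.
  rewrite wprodM//; last by move=> i; exact: mxpow_ge0.
  rewrite wprod_mxpow//; [|exact: b_ge0|exact: Hd_mx_ge0 F_Hd].
  by rewrite mulrAC -wprodM// ga wprod1 mul1r.
exists (scale a w), lambda; split => //.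
- split; first by move/KplusP: wK => wK; apply/KplusP => i j; rewrite scaleE mulr_ge0.
  move=> i; have /matrixP/(_ i 0) := ga; rewrite -(@block_norms_scale _ _ _ gamma)//.
  by rewrite !mxE.
- rewrite (Hd_scale F_Hd)// Fw !scale_hadamard; congr scale.
  apply/matrixP => i j; rewrite ord1 !mxE -[LHS]mulr1 -!mulrA; congr (_ * (_ * _)).
  by have := g0 i; rewrite mxE => gi; rewrite mulfV// gt_eqF.
move=> e; rewrite lambdaE => nue.
have [s s0 se] := lt_wprod_addr b_gt0 nu0 nue.
have [v vK Fv] := wv s s0; exists v, (\col_i (nu i 0 + s)); split => //.
- by move=> i; rewrite mxE ltr_wpDl.
- by move=> i j; rewrite mxE.
Qed.

End SpectralRadius.

(** * Limits in the extended reals and the variational formulas *)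

Lemma limn_esup_le_near {R : realType} (f : nat -> \bar R) (l : \bar R) :
  (\forall m \near \oo, (f m <= l)%E) -> (limn_esup f <= l)%E.
Proof.
move=> fl; apply: (@le_trans _ _ (ereal_sup (f @` [set m | (f m <= l)%E]))).
  by apply: ereal_inf_lbound; exists [set m | (f m <= l)%E].
by apply: ge_ereal_sup => _ [m /= ml <-].
Qed.

Lemma cvge_sandwich {R : realType} (f : nat -> \bar R) (r : R) :
  (\forall m \near \oo, (r%:E <= f m)%E) ->
  (forall e, r < e -> \forall m \near \oo, (f m <= e%:E)%E) ->
  f @ \oo --> r%:E.
Proof.
move=> rf fe; apply/fine_cvgP; split.
  apply: filterS2 rf (fe (r + 1) _) => [m|]; last by rewrite ltrDl.
  by case: (f m).
apply/cvgrPdist_le => e e0.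
apply: filterS2 rf (fe (r + e) _) => [m|]; last by rewrite ltrDl.
rewrite /=; case: (f m) => // s; rewrite !lee_fin => rs se.
by rewrite /= distrC ger0_norm ?subr_ge0// lerBlDl.
Qed.


Theorem theorem4p1 (R : realType) (d : nat) (d_gt0 : (0 < d)%N)
    (n : 'I_d -> nat) (n_gt0 : forall i, (0 < n i)%N)
    (gamma : forall i, 'cV[R]_(n i) -> R)
    (gamma_norm : forall i, is_norm (gamma i))
    (gamma_mono : forall i, monotonic (gamma i))
    (F : pvec R n -> pvec R n) (A : 'M[R]_d) (F_Hd : in_Hd F A)
    (b : 'cV[R]_d) (b_pos : b \is a mxOver Num.pos)
    (b_sum : \sum_i b i 0 = 1) (b_eigen : A^T *m b = b) :
  (exists (u : pvec R n) (lambda : 'cV[R]_d),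
    [/\ Splus gamma u, lambda \is a mxOver Num.nneg, F u = scale lambda u &
        spectral_radius gamma b F = (\prod_i (lambda i 0) `^ (b i 0))%:E]) /\
  spectral_radius gamma b F =
    ereal_sup [set limn_esup (growth gamma b F x) | x in Kplus0] /\
  (fun m : nat => ereal_sup [set growth gamma b F x m | x in Splus gamma])
    @ \oo --> spectral_radius gamma b F.
Proof.
have b_gt0 i : 0 < b i 0 by have /mxOverP/(_ i 0) := b_pos; rewrite posrE.
have [u [lambda [uS lambda0 Fu uv]]] :=
  maximal_eigenvector n_gt0 gamma_norm gamma_mono F_Hd b_gt0 b_eigen.
have growth_u m : growth gamma b F u m.+1 = (wprod b lambda)%:E.
  exact: (growth_eigenvector gamma_norm gamma_mono F_Hd b_gt0 b_eigen).
have growth_le e x : wprod b lambda < e -> Kplus x ->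
    \forall m \near \oo, (growth gamma b F x m <= e%:E)%E.
  move=> /uv[v [mu [vK mu0 Fv mue]]] xK.
  have [t t0 xt] := Kplus_bound vK xK.
  have := growth_near_le gamma_norm gamma_mono F_Hd b_gt0 b_eigen mu0 t0
    (Kpos_Kplus vK) Fv mue.
  by apply: filterS => m; exact.
have sup_le e : wprod b lambda < e -> \forall m \near \oo,
    (ereal_sup [set growth gamma b F x m | x in Splus gamma] <= e%:E)%E.
  move=> /uv[v [mu [vK mu0 Fv mue]]].
  have [t t0 xt] := Splus_bound gamma_norm gamma_mono vK.
  have := growth_near_le gamma_norm gamma_mono F_Hd b_gt0 b_eigen mu0 t0
    (Kpos_Kplus vK) Fv mue.
  apply: filterS => m mP; apply: ge_ereal_sup => _ [x xS <-].
  by apply: mP; [case: xS|exact: xt].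
(* The growth bounds hold only for e strictly above [wprod b lambda]; this lets e decrease to it. *)
have le_lambda (y : \bar R) : (forall e, wprod b lambda < e -> (y <= e%:E)%E) ->
    (y <= (wprod b lambda)%:E)%E.
  move=> ye; apply/lee_addgt0Pr => e e0; apply: ye.
  by rewrite ltrDl.
have rE : spectral_radius gamma b F = (wprod b lambda)%:E.
  apply/le_anti/andP; split; last first.
    apply: ereal_sup_ubound; exists u, lambda; split => //.
    by apply/mxOverP => i j; rewrite ord1 nnegrE.
  apply: ge_ereal_sup => _ [x [mu [xS mu0 Fx ->]]]; apply: le_lambda => e le.
  have mu_ge0 i : 0 <= mu i 0 by have /mxOverP/(_ i 0) := mu0; rewrite nnegrE.
  (* The growth of an eigenvector equals the weighted product of its eigenvalue at every positive m,
     so one large m suffices. *)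
  have [N _ /(_ N.+1 (leqnSn N))] := growth_le e x le xS.1.
  by rewrite /= (growth_eigenvector gamma_norm gamma_mono F_Hd b_gt0 b_eigen _ mu_ge0).
rewrite rE; split; [|split].
- exists u, lambda; split => //.
  by apply/mxOverP => i j; rewrite ord1 nnegrE.
- apply/le_anti/andP; split.
    apply: ereal_sup_ubound; exists u.
      split; first by case: uS.
      move=> i; apply/eqP => ui; have [_ /(_ i)] := uS.
      by rewrite ui (gamma0 gamma_norm) => /esym/eqP; rewrite oner_eq0.
    (* The growth of [u] is constant from m = 1 on, so it converges and its limit superior is that
       limit. *)
    apply: (cvg_limn_einf_sup _).2; apply: cvge_sandwich => [|e le].
      by exists 1%N => // -[//|m] _; rewrite /= growth_u.
    by apply: growth_le => //; case: uS.
  apply: ge_ereal_sup => _ [x [xK _] <-]; apply: le_lambda => e le.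
  by apply: limn_esup_le_near; exact: growth_le.
apply: cvge_sandwich => //; exists 1%N => // -[//|m] _.
by apply: ereal_sup_ubound; exists u.
Qed.
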